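(* Each poset in the following list is null-taxotopic: (1) a total order; (2) the cone $CP$ for any poset $P$, and hence any complete lattice; (3) any arbitrary copower (i.e. disjoint union of copies) of any poset in this list.
   Context: For a poset $P$, $\mathrm{Adj}(P)$ is the set of adjoint pairs (monotone Galois connections) $f=(f^*\dashv f_* )$ of monotone maps $f^*,f_*:P\to P$, i.e. $f^*(p)\le q\iff p\le f_*(q)$. For $p,q\in P$, write $p\preceq q$ if there is $f\in\mathrm{Adj}(P)$ with $f^*(q)=p$ and $f_*(p)=q$. This is a preorder on $P$, called the taxotopy preorder. A monotone map $h:Q\to P$ between posets is continuous if $q\preceq q'$ in $Q$ implies $h(q)\preceq h(q')$ in $P$. A weak adjunction is a pair of continuous monotone maps $h^+:Q\to P$, $h_+:P\to Q$ such that $q\preceq h_+h^+(q)$ for all $q\in Q$ and $h^+h_+(p)\preceq p$ for all $p\in P$; $h^+$ is the left and $h_+$ the right weak adjoint. A poset $P$ is taxotopic to a poset $Q$, written $P\preceq Q$, if there is a weak adjunction whose right adjoint goes from $P$ to $Q$ (and whose left adjoint goes from $Q$ to $P$). $P$ and $Q$ are taxotopy equivalent if $P\preceq Q$ and $Q\preceq P$. A poset is null-taxotopic if it is taxotopy equivalent to the one-element poset $\mathbf 1$. The cone $CP$ is obtained from $P$ by adjoining two new elements $\top,\bot$ with $\bot<p<\top$ for all $p\in P$ (and $\bot<\top$).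
   Formalization: Total orders are taken nonempty and copowers are taken over a nonempty index set, since the empty poset is not null-taxotopic (there is no map from the one-element poset to it). *)

(* Defs.v *)
From HB Require Import structures.
From mathcomp Require Import all_boot all_order.
From mathcomp Require Import boolp classical_sets.

Set Implicit Arguments.
Unset Strict Implicit.
Unset Printing Implicit Defensive.

Import Order.Theory.
Local Open Scope order_scope.

Section Taxotopy.
Context {d : Order.disp_t} {P : porderType d}.

(* [adjoint_pair l r] is the membership (l -| r) \in Adj(P), l the left adjoint. *)
Definition adjoint_pair (l r : P -> P) : Prop :=
  [/\ Order.nondecreasing l, Order.nondecreasing r &
      forall p q : P, (l p <= q) = (p <= r q)].

Definition taxle (p q : P) : Prop :=
  exists l r : P -> P, [/\ adjoint_pair l r, l q = p & r p = q].

End Taxotopy.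

Definition tax_continuous {d d' : Order.disp_t} {Q : porderType d}
    {P : porderType d'} (h : Q -> P) : Prop :=
  Order.nondecreasing h /\ forall q q' : Q, taxle q q' -> taxle (h q) (h q').

(* [l : Q -> P] is the left and [r : P -> Q] the right weak adjoint. *)
Definition weak_adjunction {d d' : Order.disp_t} {Q : porderType d}
    {P : porderType d'} (l : Q -> P) (r : P -> Q) : Prop :=
  [/\ tax_continuous l, tax_continuous r,
      forall q : Q, taxle q (r (l q)) &
      forall p : P, taxle (l (r p)) p].

Definition taxotopic {d d' : Order.disp_t} (P : porderType d)
    (Q : porderType d') : Prop :=
  exists (l : Q -> P) (r : P -> Q), weak_adjunction l r.

Definition taxotopy_equivalent {d d' : Order.disp_t} (P : porderType d)
    (Q : porderType d') : Prop :=
  taxotopic P Q /\ taxotopic Q P.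

(* ['I_1] is the one-element poset. *)
Definition null_taxotopic {d : Order.disp_t} (P : porderType d) : Prop :=
  taxotopy_equivalent P 'I_1.

Inductive cone (P : Type) : Type :=
  | cone_bot
  | cone_in of P
  | cone_top.
Arguments cone_bot {P}.
Arguments cone_top {P}.

Section ConeChoice.
Context {P : Type}.

Definition cone_encode (x : cone P) : option (option P) :=
  match x with
  | cone_bot => None
  | cone_in p => Some (Some p)
  | cone_top => Some None
  end.

Definition cone_decode (x : option (option P)) : cone P :=
  match x with
  | None => cone_bot
  | Some (Some p) => cone_in p
  | Some None => cone_top
  end.

Lemma cone_encodeK : cancel cone_encode cone_decode.
Proof. by case. Qed.

End ConeChoice.

HB.instance Definition _ (P : eqType) :=
  Equality.copy (cone P) (can_type (@cone_encodeK P)).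
HB.instance Definition _ (P : choiceType) :=
  Choice.copy (cone P) (can_type (@cone_encodeK P)).

Section ConeOrder.
Context {d : Order.disp_t} {P : porderType d}.

Definition cone_le (x y : cone P) : bool :=
  match x, y with
  | cone_bot, _ => true
  | _, cone_top => true
  | cone_in p, cone_in q => p <= q
  | _, _ => false
  end.

Lemma cone_le_refl : reflexive cone_le.
Proof. by case=> //= p; exact: lexx. Qed.

Lemma cone_le_anti : antisymmetric cone_le.
Proof. by move=> [|p|] [|q|] //= /le_anti ->. Qed.

Lemma cone_le_trans : transitive cone_le.
Proof. by move=> [|q|] [|p|] [|r|] //=; exact: le_trans. Qed.

HB.instance Definition _ := Order.Le_isPOrder.Build d (cone P)
  cone_le_refl cone_le_anti cone_le_trans.

End ConeOrder.

(* The disjoint union of copies of P indexed by I.  This is an alias of the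
   product type, ordered with I discrete: elements of distinct copies are
   incomparable. *)
Definition copower (I P : Type) : Type := (I * P)%type.

HB.instance Definition _ (I P : choiceType) :=
  Choice.copy (copower I P) (I * P)%type.

Section CopowerOrder.
Context {d : Order.disp_t} {I : choiceType} {P : porderType d}.

Definition copower_le (x y : copower I P) : bool :=
  (x.1 == y.1) && (x.2 <= y.2).

Lemma copower_le_refl : reflexive copower_le.
Proof. by move=> x; rewrite /copower_le eqxx lexx. Qed.

Lemma copower_le_anti : antisymmetric copower_le.
Proof.
move=> [i p] [j q]; rewrite /copower_le /=.
by move=> /andP[/andP[/eqP-> pq] /andP[_ qp]]; rewrite (@le_anti _ _ p q) ?pq.
Qed.

Lemma copower_le_trans : transitive copower_le.
Proof.
move=> [j q] [i p] [k r]; rewrite /copower_le /=.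
by move=> /andP[/eqP-> pq] /andP[-> /(le_trans pq)].
Qed.

HB.instance Definition _ := Order.Le_isPOrder.Build d (copower I P)
  copower_le_refl copower_le_anti copower_le_trans.

End CopowerOrder.

Definition complete_lattice {d : Order.disp_t} (L : porderType d) : Prop :=
  forall A : set L, (supremums A !=set0)%classic /\ (infimums A !=set0)%classic.

(* Total orders and index sets of copowers are nonempty: the empty poset is not
   taxotopic to the one-element poset, as there is no map to it from 'I_1.
   The last constructor is recursive, so copowers may be iterated. *)
Inductive listed : forall d : Order.disp_t, porderType d -> Prop :=
  | listed_total (d : Order.disp_t) (T : orderType d) :
      inhabited T -> listed T
  | listed_cone (d : Order.disp_t) (P : porderType d) :
      listed (cone P : porderType d)
  | listed_complete_lattice (d : Order.disp_t) (L : porderType d) :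
      complete_lattice L -> listed L
  | listed_copower (d : Order.disp_t) (P : porderType d) (I : choiceType) :
      inhabited I -> listed P -> listed (copower I P : porderType d).

(* Main.v *)
Require Import Defs.
From mathcomp Require Import all_boot all_order.
From mathcomp Require Import boolp classical_sets.

(** Maps from and to the one-element poset are constant, so a poset is
null-taxotopic as soon as its taxotopy preorder has a least element [b] and a
greatest element [t] ([null_taxotopic_of_bounded]).  Such bounds are found in
each case by writing down adjoint pairs.

- If the poset has a bottom and a top (cones, complete lattices), these are the
  bounds ([bot_taxle], [taxle_top]).
- In a total order, [p <= q] implies that [p] is below [q] in the taxotopy
  preorder ([le_taxle]), so a minimum or a maximum is a bound.  The reverse
  relation holds for elements that are not extremal: if [a < p < q < c], then
  [q] is below [p] ([taxle_interior]).  Without a maximum, every element that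
  is not the minimum is therefore a greatest element of the taxotopy preorder,
  and dually.
- In a copower, an adjoint pair of the base poset acts on all the copies at
  once, and may be combined with a transposition of two copies; hence a bound
  of the base poset, placed in any copy, is a bound of the copower. *)

Set Implicit Arguments.
Unset Strict Implicit.
Unset Printing Implicit Defensive.

Import Order.Theory.
Local Open Scope order_scope.

(** The taxotopy preorder of [P] has a least and a greatest element (neither
need be unique). *)
Definition tax_bounded (d : Order.disp_t) (P : porderType d) : Prop :=
  (exists b : P, forall p, taxle b p) /\ (exists t : P, forall p, taxle p t).

Section General.
Context {d : Order.disp_t} {P : porderType d}.
Implicit Types (l r : P -> P) (p q : P).

(** Monotonicity of both maps follows from the adjunction equivalence. *)
Lemma galois_adjoint_pair l r :
  (forall p q, (l p <= q) = (p <= r q)) -> adjoint_pair l r.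
Proof.
move=> adj; split=> // x y xy.
- by rewrite adj (le_trans xy) // -adj.
- by rewrite -adj (le_trans _ xy) // adj.
Qed.

Lemma taxle_refl p : taxle p p.
Proof. by exists id, id; split=> //; exact: galois_adjoint_pair. Qed.

(** If [b] is a bottom and [t] a top, the left adjoint sends the elements below
[p] to [b] and the others to [t]. *)
Lemma bot_taxle (b t : P) :
  (forall x, b <= x) -> (forall x, x <= t) -> forall p, taxle b p.
Proof.
move=> b_min t_max p.
exists (fun x => if x <= p then b else t), (fun y => if y == t then t else p).
split; [apply: galois_adjoint_pair => x y| by rewrite lexx|].
- case: eqP => [->|/eqP y_neq_t]; first by rewrite !t_max.
  case: ifP => _; first exact: b_min.
  by apply/negbTE; apply: contra y_neq_t => ty; rewrite eq_le t_max.
- case: eqP => // b_eq_t; apply/le_anti.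
  by rewrite t_max -b_eq_t b_min.
Qed.

Lemma taxle_top (b t : P) :
  (forall x, b <= x) -> (forall x, x <= t) -> forall p, taxle p t.
Proof.
move=> b_min t_max p.
exists (fun x => if x == b then b else p), (fun y => if p <= y then t else b).
split; [apply: galois_adjoint_pair => x y| |by rewrite lexx].
- case: eqP => [->|/eqP x_neq_b]; first by rewrite !b_min.
  case: ifP => _; first by rewrite t_max.
  by apply/esym/negbTE; apply: contra x_neq_b => xb; rewrite eq_le b_min andbT.
- case: eqP => // t_eq_b; apply/le_anti.
  by rewrite b_min -t_eq_b t_max.
Qed.

Lemma tax_bounded_of_bot_top (b t : P) :
  (forall x, b <= x) -> (forall x, x <= t) -> tax_bounded P.
Proof.
by move=> b_min t_max; split; [exists b; exact: (bot_taxle b_min t_max)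
  | exists t; exact: (taxle_top b_min t_max)].
Qed.

End General.

Lemma tax_continuous_const (d d' : Order.disp_t) (Q : porderType d)
  (P : porderType d') (p : P) : tax_continuous (fun _ : Q => p).
Proof. by split=> [x y _ | x y _]; [exact: lexx | exact: taxle_refl]. Qed.

Lemma null_taxotopic_of_bounded (d : Order.disp_t) (P : porderType d) :
  tax_bounded P -> null_taxotopic P.
Proof.
move=> [[b b_min] [t t_max]]; split.
- exists (fun=> b), (fun=> ord0); split=> //; try exact: tax_continuous_const.
  by move=> q; rewrite (ord1 q); exact: taxle_refl.
- exists (fun=> ord0), (fun=> t); split=> //; try exact: tax_continuous_const.
  by move=> p; rewrite (ord1 p); exact: taxle_refl.
Qed.

Section Total.
Context {d : Order.disp_t} {T : orderType d}.
Implicit Types p q x y : T.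

Lemma le_taxle p q : p <= q -> taxle p q.
Proof.
move=> pq.
(* The interval [p, q] is collapsed to p by the left adjoint and to q by the
   right adjoint; all other elements are fixed. *)
exists (fun x => if x <= q then Order.min x p else x),
       (fun y => if p <= y then Order.max q y else y).
split; [apply: galois_adjoint_pair => x y | | ].
- case: ifPn => [xq|/negbTE qx]; case: ifPn => [py|/negbTE yp].
  + by rewrite ge_min le_max py xq orbT.
  + by rewrite ge_min yp orbF.
  + by rewrite le_max qx.
  + by [].
- by rewrite lexx (min_idPr pq).
- by rewrite lexx (max_idPl pq).
Qed.

Lemma taxle_interior a p q c : a < p -> p < q -> q < c -> taxle q p.
Proof.
move=> ap pq qc.
(* The left adjoint fixes the elements up to a, sends ]a, p] to q, and
   everything above p to at least c. *)
exists (fun x => if x <= a then x else if x <= p then q else Order.max x c),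
       (fun y => if c <= y then y else if q <= y then p else Order.min y a).
split; [apply: galois_adjoint_pair => x y | | ].
- case: (leP c y) => [cy|yc].
    have qy : q <= y := ltW (lt_le_trans qc cy).
    case: (leP x a) => // _; case: (leP x p) => [xp|_].
      by rewrite qy (le_trans xp) // (le_trans (ltW pq)).
    by rewrite ge_max cy andbT.
  case: (leP q y) => [qy|yq].
    case: (leP x a) => [xa|_].
      have xp : x <= p := le_trans xa (ltW ap).
      by rewrite xp (le_trans xp) // (le_trans (ltW pq)).
    case: (leP x p) => [//|_]; by rewrite ge_max [c <= y]leNgt yc andbF.
  rewrite le_min; case: (leP x a) => [_|_]; first by rewrite andbT.
  rewrite andbF; case: (leP x p) => _; first by rewrite leNgt yq.
  by rewrite ge_max [c <= y]leNgt yc andbF.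
- by rewrite leNgt ap lexx.
- by rewrite [c <= q]leNgt qc lexx.
Qed.

Lemma exists_minimum_or_no_minimum :
  (exists b : T, forall x, b <= x) \/ (forall x : T, exists y, y < x).
Proof.
have [|no_min] := pselect (exists b : T, forall x, b <= x); first by left.
right=> x; apply: contrapT => no_lt; apply: no_min; exists x => y.
by rewrite leNgt; apply/negP => yx; apply: no_lt; exists y.
Qed.

Lemma exists_maximum_or_no_maximum :
  (exists t : T, forall x, x <= t) \/ (forall x : T, exists y, x < y).
Proof.
have [|no_max] := pselect (exists t : T, forall x, x <= t); first by left.
right=> x; apply: contrapT => no_gt; apply: no_max; exists x => y.
by rewrite leNgt; apply/negP => xy; apply: no_gt; exists y.
Qed.

Lemma tax_bounded_total : inhabited T -> tax_bounded T.
Proof.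
move=> [x0]; split.
- have [[b b_min]|lt_ex] := exists_minimum_or_no_minimum.
    by exists b => p; exact: le_taxle.
  (* Any element that is not the maximum works. *)
  have [b bx0] := lt_ex x0; exists b => p.
  have [bp|pb] := leP b p; first exact: le_taxle.
  have [a ap] := lt_ex p; exact: taxle_interior ap pb bx0.
- have [[t t_max]|gt_ex] := exists_maximum_or_no_maximum.
    by exists t => p; exact: le_taxle.
  have [t x0t] := gt_ex x0; exists t => p.
  have [pt|tp] := leP p t; first exact: le_taxle.
  have [c pc] := gt_ex p; exact: taxle_interior x0t tp pc.
Qed.

End Total.

Lemma tax_bounded_cone (d : Order.disp_t) (P : porderType d) :
  tax_bounded (cone P : porderType d).
Proof.
apply: (@tax_bounded_of_bot_top d (cone P : porderType d)
          cone_bot cone_top).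
- by [].
- by case.
Qed.

Lemma tax_bounded_complete_lattice (d : Order.disp_t) (L : porderType d) :
  complete_lattice L -> tax_bounded L.
Proof.
move=> /(_ setT) [[t [t_ub _]] [b [b_lb _]]].
by apply: (@tax_bounded_of_bot_top _ _ b t) => x; [exact: b_lb | exact: t_ub].
Qed.

Section Copower.
Context {d : Order.disp_t} {P : porderType d} {I : choiceType}.

(** The transposition of two elements of a type that need not be finite. *)
Definition transp (i j k : I) : I :=
  if k == i then j else if k == j then i else k.

Lemma transpK i j : involutive (transp i j).
Proof.
move=> k; rewrite /transp.
case: (eqVneq k i) => [->|ki]; first by case: (eqVneq j i); rewrite ?eqxx.
by case: (eqVneq k j) => [->|kj]; rewrite ?eqxx // (negbTE ki) (negbTE kj).
Qed.

Lemma taxle_copower (i j : I) (p q : P) :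
  taxle p q -> taxle ((i, p) : copower I P) ((j, q) : copower I P).
Proof.
move=> [l [r [[_ _ adj] lq rp]]].
exists (fun x : copower I P => (transp i j x.1, l x.2) : copower I P),
       (fun x : copower I P => (transp i j x.1, r x.2) : copower I P).
split; first apply: galois_adjoint_pair => x y.
- rewrite /Order.le /= /copower_le /= adj.
  by rewrite (can2_eq (transpK i j) (transpK i j)).
- by rewrite /= lq /transp eqxx; case: eqP => [->|].
- by rewrite /= rp /transp eqxx.
Qed.

Lemma tax_bounded_copower :
  inhabited I -> tax_bounded P -> tax_bounded (copower I P : porderType d).
Proof.
move=> [i] [[b b_min] [t t_max]]; split.
- by exists (i, b) => -[j p]; exact: taxle_copower.
- by exists (i, t) => -[j p]; exact: taxle_copower.
Qed.

End Copower.

Lemma listed_tax_bounded (d : Order.disp_t) (P : porderType d) :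
  listed P -> tax_bounded P.
Proof.
elim=> {d P} [d T|d P|d L|d P I I_inh _].
- exact: tax_bounded_total.
- exact: tax_bounded_cone.
- exact: tax_bounded_complete_lattice.
- exact: tax_bounded_copower.
Qed.

Theorem proposition7p3 (d : Order.disp_t) (P : porderType d) (hP : listed P) :
  null_taxotopic P.
Proof. exact: null_taxotopic_of_bounded (listed_tax_bounded hP). Qed.
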